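(* Let $\{P_n(z)\}_{n=0}^\infty$ be a monic OPS with respect to a positive-definite linear functional $\mathcal{L}$ and let $\kappa_1\in\mathbb{C}_\pm$ and $\kappa_2\in\mathbb{C}_\mp$ (opposite open half-planes). Let $\{P_n^{**}(\kappa_1,\kappa_2,z)\}_{n=0}^\infty$ be the corresponding iterated kernel polynomials, and for $n\ge1$ let $S_{n+1}(z)$ be a quasi-orthogonal polynomial of order $2$ and degree $n+1$, i.e. $S_{n+1}(z)=P_{n+1}(z)+\tilde C_nP_n(z)+\tilde D_nP_{n-1}(z)$ with $\tilde C_n,\tilde D_n\in\mathbb{C}$. Then there exist unique sequences of constants $\gamma_n,\upsilon_n,\rho_n$ such that $$S_{n+1}(z)-(\rho_nz-\gamma_n)P_n(z)+\upsilon_n(z-\kappa_1)(z-\kappa_2)P_{n-1}^{**}(\kappa_1,\kappa_2,z)=0,\quad n\ge1.$$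
   Context: $\mathbb{C}_\pm=\{z\in\mathbb{C}:\pm\operatorname{Im}z>0\}$. A linear functional $\mathcal{L}:\mathbb{C}[z]\to\mathbb{C}$ is positive-definite if $\mathcal{L}[p]>0$ for every polynomial $p$ that is not identically zero and is non-negative on $\mathbb{R}$. A monic orthogonal polynomial system (OPS) is a sequence of monic polynomials $P_n$ with $\deg P_n=n$, $\mathcal{L}[P_nP_m]=0$ for $n\neq m$, and $\mathcal{L}[P_n^2]\neq0$ for all $n$. The kernel polynomials are $P_n^*(\kappa_1,z)=(z-\kappa_1)^{-1}\left[P_{n+1}(z)-\frac{P_{n+1}(\kappa_1)}{P_n(\kappa_1)}P_n(z)\right]$, and the iterated kernel polynomials are $$P_n^{**}(\kappa_1,\kappa_2,z)=(z-\kappa_2)^{-1}\left[P_{n+1}^*(\kappa_1,z)-\frac{P_{n+1}^*(\kappa_1,\kappa_2)}{P_n^*(\kappa_1,\kappa_2)}P_n^*(\kappa_1,z)\right],\quad n\ge0,$$ which are well defined for these $\kappa_1,\kappa_2$ and form the monic OPS for the functional $p\mapsto\mathcal{L}[(z-\kappa_1)(z-\kappa_2)p(z)]$. *)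

(* Defs.v *)
From mathcomp Require Import all_boot all_order all_algebra.
From mathcomp Require Import reals complex.

Set Implicit Arguments.
Unset Strict Implicit.
Unset Printing Implicit Defensive.

Import Order.TTheory GRing.Theory Num.Theory.
Local Open Scope ring_scope.
Local Open Scope complex_scope.

(* [0 <= z] and [0 < z] in R[i] entail that z is real. *)
Definition positive_definite (R : realType) (L : {scalar {poly R[i]}}) : Prop :=
  forall p : {poly R[i]}, p != 0 -> (forall x : R, 0 <= p.[x%:C]) -> 0 < L p.

Definition monic_OPS (R : realType) (L : {scalar {poly R[i]}})
    (P : nat -> {poly R[i]}) : Prop :=
  [/\ forall n, P n \is monic,
      forall n, size (P n) = n.+1,
      forall n m, n != m -> L (P n * P m) = 0
    & forall n, L (P n ^+ 2) != 0].

(* The bracket vanishes at k when P n does not, so the polynomial quotient is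
   then exact; see [kernel_polyE]. *)
Definition kernel_poly (F : fieldType) (P : nat -> {poly F}) (k : F) (n : nat) :
    {poly F} :=
  (P n.+1 - ((P n.+1).[k] / (P n).[k]) *: P n) %/ ('X - k%:P).

Lemma kernel_polyE (F : fieldType) (P : nat -> {poly F}) (k : F) (n : nat) :
  (P n).[k] != 0 ->
  ('X - k%:P) * kernel_poly P k n =
    P n.+1 - ((P n.+1).[k] / (P n).[k]) *: P n.
Proof.
move=> Pk; rewrite mulrC divpK // dvdp_XsubCl rootE !hornerE divfK //.
by rewrite subrr.
Qed.

Definition iterated_kernel_poly (F : fieldType) (P : nat -> {poly F})
    (k1 k2 : F) : nat -> {poly F} :=
  kernel_poly (kernel_poly P k1) k2.

(* Order 2, degree n.+1; meaningful for n > 0, because of P n.-1. *)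
Definition quasi_orthogonal2 (F : fieldType) (P : nat -> {poly F}) (n : nat)
    (S : {poly F}) : Prop :=
  exists c d : F, S = P n.+1 + c *: P n + d *: P n.-1.

Definition opposite_half_planes (R : realType) (z w : R[i]) : Prop :=
  (0 < complex.Im z /\ complex.Im w < 0) \/
  (complex.Im z < 0 /\ 0 < complex.Im w).

(* Main.v *)
Require Import Defs.
From mathcomp Require Import all_boot all_order all_algebra.
From mathcomp Require Import boolp reals complex ring.

(* Put lambda_n = L[P_n^2] / L[P_(n-1)^2].  By the three-term recurrence,
   z P_n = P_(n+1) + beta_n P_n + lambda_n P_(n-1), and unfolding the kernel
   polynomials gives (z - kappa1)(z - kappa2) P**_(n-1) = P_(n+1) + a P_n + b P_(n-1).
   So the relation is a linear system for (gamma, upsilon, rho), which is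
   uniquely solvable as soon as b <> lambda_n.  Positivity makes beta_n real and
   lambda_n > 0, so that P_(n+1)/P_n maps each open half-plane to itself;
   hence its values at kappa1 and kappa2 are nonzero and distinct.  This makes
   the kernel quotients exact, and b - lambda_n nonzero. *)

Set Implicit Arguments.
Unset Strict Implicit.
Unset Printing Implicit Defensive.

Import Order.TTheory GRing.Theory Num.Theory.
Local Open Scope ring_scope.
Local Open Scope complex_scope.

(** * Orthogonal expansions and the three-term recurrence *)

Section Orthogonality.

Variables (R : realType) (L : {scalar {poly R[i]}}) (P : nat -> {poly R[i]}).
Hypothesis P_OPS : monic_OPS L P.

(** Since [P n] is monic of degree [n], the subtraction cancels the top coefficient. The inductions
    on degree below rest on this reduction. *)
Lemma size_sub_lead (p : {poly R[i]}) (n : nat) :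
  (size p <= n.+1)%N -> (size (p - p`_n *: P n)%R <= n)%N.
Proof.
case: P_OPS => Pm Ps _ _ sp; apply/leq_sizeP => j; rewrite leq_eqVlt.
have Pn1 : (P n)`_n = 1.
  by have /monicP := Pm n; rewrite lead_coefE Ps.
rewrite coefB coefZ => /predU1P[<-|nj]; first by rewrite Pn1 mulr1 subrr.
rewrite (nth_default _ (leq_trans sp nj)) [(P n)`_j]nth_default ?Ps //.
by rewrite mulr0 subrr.
Qed.

Lemma OPS_orth_lower (q : {poly R[i]}) (m n : nat) :
  (size q <= n)%N -> (n <= m)%N -> L (q * P m) = 0.
Proof.
case: P_OPS => _ _ PO _.
elim: n q => [|n IHn] q sq nm.
  by move: sq; rewrite leqn0 size_poly_eq0 => /eqP->; rewrite mul0r linear0.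
rewrite -[q](subrK (q`_n *: P n)) mulrDl linearD /=.
rewrite IHn ?size_sub_lead ?(ltnW nm) // add0r -scalerAl linearZ /=.
by rewrite PO ?mulr0 // neq_ltn nm.
Qed.

(** Pairing with [P n] isolates the top coefficient, as [L (P n ^+ 2)] is nonzero. The recurrence is
    proved this way, by testing the difference of its two sides against each [P m]. *)
Lemma OPS_orth_eq0 (n : nat) (q : {poly R[i]}) :
  (size q <= n)%N -> (forall m, (m < n)%N -> L (q * P m) = 0) -> q = 0.
Proof.
case: P_OPS => _ _ _ Pn.
elim: n q => [|n IHn] q sq qO.
  by move: sq; rewrite leqn0 size_poly_eq0 => /eqP.
have sq' := size_sub_lead sq.
have qn0 : q`_n = 0.
  have := qO n (ltnSn n).
  rewrite -{1}[q](subrK (q`_n *: P n)) mulrDl linearD /=.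
  rewrite (OPS_orth_lower sq') // add0r -scalerAl linearZ /= -expr2.
  by move/eqP; rewrite mulf_eq0 (negPf (Pn n)) orbF => /eqP.
move: sq'; rewrite qn0 scale0r subr0 => sq'.
by apply: IHn => // m mn; apply: qO; rewrite ltnS ltnW.
Qed.

(** ['X * P n] is [P n.+1] plus terms of lower degree, which are orthogonal to [P n.+1]. *)
Lemma OPS_shift (n : nat) : L ('X * P n * P n.+1) = L (P n.+1 ^+ 2).
Proof.
case: P_OPS => Pm Ps _ _.
have sX : size ('X * P n) = n.+2 by rewrite mulrC size_mulX -?size_poly_gt0 Ps.
have := @size_sub_lead ('X * P n) n.+1; rewrite sX leqnn => /(_ isT).
have -> : ('X * P n)`_n.+1 = 1.
  by rewrite coefXM /=; have /monicP := Pm n; rewrite lead_coefE Ps.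
rewrite scale1r => sq; rewrite -[X in L (X * _)](subrK (P n.+1)).
by rewrite mulrDl linearD /= (OPS_orth_lower sq) // add0r expr2.
Qed.

Definition OPS_beta (n : nat) : R[i] := L ('X * P n ^+ 2) / L (P n ^+ 2).
(* The index is shifted: [OPS_lambda n] is the usual lambda_(n+1). *)
Definition OPS_lambda (n : nat) : R[i] := L (P n.+1 ^+ 2) / L (P n ^+ 2).

Lemma OPS0 : P 0%N = 1.
Proof.
case: P_OPS => Pm Ps _ _.
have /monicP := Pm 0%N; rewrite lead_coefE Ps /= => P00.
by rewrite [P 0%N]size1_polyC ?Ps // P00.
Qed.

Lemma OPS1 : P 1%N = 'X - (OPS_beta 0)%:P.
Proof.
case: P_OPS => Pm Ps PO Pn.
pose q := 'X - (OPS_beta 0)%:P - P 1%N.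
suff: q = 0 by move/eqP; rewrite subr_eq0 => /eqP.
apply: (@OPS_orth_eq0 1) => [|[|//] _].
  have := @size_sub_lead ('X - (OPS_beta 0)%:P) 1; rewrite size_XsubC.
  by rewrite coefB coefX coefC /= subr0 scale1r; apply.
rewrite /q !mulrBl !linearB /= PO // subr0 /OPS_beta OPS0.
have L1 : L 1 != 0 by have := Pn 0%N; rewrite OPS0 expr1n.
by rewrite expr1n !mulr1 -alg_polyC linearZ /= divfK // subrr.
Qed.

Lemma OPS_recurrence (n : nat) :
  P n.+2 = ('X - (OPS_beta n.+1)%:P) * P n.+1 - OPS_lambda n *: P n.
Proof.
case: P_OPS => Pm Ps PO Pn.
pose q := ('X - (OPS_beta n.+1)%:P) * P n.+1 - OPS_lambda n *: P n - P n.+2.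
suff: q = 0 by move/eqP; rewrite subr_eq0 => /eqP.
pose u := ('X - (OPS_beta n.+1)%:P) * P n.+1.
have mu : u \is monic by rewrite monicMl ?monicXsubC.
have su : size u = n.+3.
  by rewrite size_monicM ?monicXsubC -?size_poly_gt0 ?Ps // size_XsubC.
have sq : (size q <= n.+2)%N.
  have := @size_sub_lead u n.+2; rewrite su leqnn => /(_ isT).
  have -> : u`_n.+2 = 1 by have /monicP := mu; rewrite lead_coefE su.
  rewrite scale1r => sq.
  rewrite /q -/u addrAC (leq_trans (size_polyD _ _)) // geq_max sq size_polyN.
  by rewrite (leq_trans (size_scale_leq _ _)) // Ps.
apply: (OPS_orth_eq0 sq) => m; rewrite ltnS => mn.
have Lq : L (q * P m) = L ('X * P m * P n.+1) - OPS_beta n.+1 * L (P n.+1 * P m)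
                         - OPS_lambda n * L (P n * P m).
  rewrite /q !mulrBl !linearB /= (PO n.+2) ?subr0; last first.
    by rewrite neq_ltn ltnS mn orbT.
  by rewrite -scalerAl mul_polyC -scalerAl !linearZ /= mulrAC.
(* The case [m = n.+1] holds by the choice of [OPS_beta], and [m = n] by [OPS_shift] and the choice
   of [OPS_lambda]. For [m < n], the degree of ['X * P m] is below [n.+1]. *)
rewrite {}Lq; move: mn; rewrite leq_eqVlt => /predU1P[->|].
  rewrite (PO n) ?neq_ltn ?ltnSn // mulr0 subr0 -mulrA -expr2.
  by rewrite divfK ?subrr.
rewrite ltnS leq_eqVlt => /predU1P[->|mn].
  rewrite (PO n.+1) ?neq_ltn ?ltnSn ?orbT // mulr0 subr0 OPS_shift -expr2.
  by rewrite divfK ?subrr.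
rewrite (PO n) ?(PO n.+1) ?neq_ltn ?mn ?(ltn_trans mn) ?orbT // !mulr0 !subr0.
apply: (@OPS_orth_lower _ _ n.+1) => //.
by rewrite mulrC size_mulX -?size_poly_gt0 Ps.
Qed.

(** Pairing with each of the three polynomials isolates its coefficient. This turns the relation of
    the theorem into three scalar equations. *)
Lemma OPS_lin_indep (n : nat) (u v w : R[i]) :
  u *: P n.+2 + v *: P n.+1 + w *: P n = 0 -> [/\ u = 0, v = 0 & w = 0].
Proof.
case: P_OPS => _ _ PO Pn E.
have Em m : u * L (P n.+2 * P m) + v * L (P n.+1 * P m) + w * L (P n * P m) = 0.
  by rewrite -!linearZ -!linearD /= !scalerAl -!mulrDl E mul0r linear0.
have nz k z : z * L (P k * P k) = 0 -> z = 0.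
  by move/eqP; rewrite -expr2 mulf_eq0 (negPf (Pn k)) orbF => /eqP.
have neq1 k : k != k.+1 by rewrite neq_ltn ltnSn.
have neq2 k : k != k.+2 by rewrite neq_ltn ltnW.
have neq1' k : k.+1 != k by rewrite eq_sym.
have neq2' k : k.+2 != k by rewrite eq_sym.
split; apply: nz.
- by rewrite -(Em n.+2) (PO n.+1) ?(PO n) // !mulr0 !addr0.
- by rewrite -(Em n.+1) (PO n.+2) ?(PO n) // !mulr0 addr0 add0r.
- by rewrite -(Em n) (PO n.+2) ?(PO n.+1) // !mulr0 !add0r.
Qed.

(** * Reality of the recurrence coefficients and action on half-planes *)

Hypothesis L_pos : positive_definite L.

Let real_on_line (p : {poly R[i]}) := forall x : R, p.[x%:C] \is Num.real.

Lemma L_sqr_gt0 (p : {poly R[i]}) : p != 0 -> real_on_line p -> 0 < L (p ^+ 2).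
Proof.
move=> p0 pr; apply: L_pos; first by rewrite expf_neq0.
by move=> x; rewrite horner_exp real_exprn_even_ge0.
Qed.

(** The polynomial ['X * P n ^+ 2] changes sign, so positivity does not apply to it directly. The
    identity [2x = (x + 1)^2 - x^2 - 1] writes it through squares. *)
Lemma OPS_beta_real (n : nat) : real_on_line (P n) -> OPS_beta n \is Num.real.
Proof.
case: P_OPS => Pm Ps _ _ Pr.
have P0 : P n != 0 by rewrite -size_poly_gt0 Ps.
have rr (x : R) : x%:C \is Num.real by rewrite complex_real.
have sqr q : q != 0 -> real_on_line q -> L (q * P n * (q * P n)) \is Num.real.
  move=> q0 qr; rewrite -expr2; apply: gtr0_real.
  apply: L_sqr_gt0; first by rewrite mulf_neq0.
  by move=> x; rewrite hornerM rpredM.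
have Xr : real_on_line 'X by move=> x; rewrite hornerX; apply: rr.
have X1r : real_on_line ('X + 1) by move=> x; rewrite !hornerE rpredD ?rr.
rewrite /OPS_beta rpredM ?rpredV ?(gtr0_real (L_sqr_gt0 P0 Pr)) //.
have -> : 'X * P n ^+ 2 = 2^-1 *: (('X + 1) * P n * (('X + 1) * P n)
              - 'X * P n * ('X * P n) - P n ^+ 2).
  have -> : ('X + 1) * P n * (('X + 1) * P n) - 'X * P n * ('X * P n) - P n ^+ 2
    = 2 *: ('X * P n ^+ 2) by rewrite -mul_polyC polyCMn; ring.
  by rewrite scalerA mulVf ?scale1r // pnatr_eq0.
rewrite linearZ !linearB /= rpredM ?rpredV ?rpredB ?realn //.
- by apply: sqr => //; rewrite -size_poly_gt0 size_XaddC.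
- by apply: sqr => //; rewrite polyX_eq0.
- exact/gtr0_real/L_sqr_gt0.
Qed.

Lemma OPS_lambda_gt0 (n : nat) :
  real_on_line (P n) -> real_on_line (P n.+1) -> 0 < OPS_lambda n.
Proof.
case: P_OPS => _ Ps _ _ Pr Pr1.
by apply: divr_gt0; apply: L_sqr_gt0; rewrite // -size_poly_gt0 Ps.
Qed.

(** Induction on two consecutive indices: reality of [P n] and [P n.+1] makes the coefficients of
    the next recurrence real. *)
Lemma OPS_real_on_line (n : nat) : real_on_line (P n).
Proof.
suff: real_on_line (P n) /\ real_on_line (P n.+1) by case.
have rr (x : R) : x%:C \is Num.real by rewrite complex_real.
elim: n => [|n [Pr Pr1]].
  have P0r : real_on_line (P 0%N) by move=> x; rewrite OPS0 hornerC.
  split=> // x; rewrite OPS1 !hornerE rpredB //; exact: OPS_beta_real.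
split=> // x; rewrite OPS_recurrence !hornerE /=.
have br := OPS_beta_real Pr1; have lr := gtr0_real (OPS_lambda_gt0 Pr Pr1).
by apply: rpredB; apply: rpredM => //; apply: rpredB.
Qed.

(** The product of imaginary parts treats both half-planes at once. A ratio off the real line is
    nonzero, which carries the nonvanishing to the next index. *)
Lemma OPS_ratio_Im (z : R[i]) (n : nat) : complex.Im z != 0 ->
  (P n).[z] != 0 /\
  0 < complex.Im z * complex.Im ((P n.+1).[z] / (P n).[z]).
Proof.
move=> z0.
have br k : complex.Im (OPS_beta k) = 0.
  have := OPS_beta_real (@OPS_real_on_line k).
  by case: (OPS_beta k) => a b; rewrite complex_real => /eqP.
elim: n => [|n [Pz IHn]].
  rewrite OPS0 OPS1 !hornerE; split; first exact: oner_neq0.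
  rewrite divr1; move: (br 0%N) z0.
  case: z (OPS_beta 0) => a b [e e'] /= -> b0.
  by rewrite subr0 -expr2 exprn_even_gt0.
have r0 : (P n.+1).[z] / (P n).[z] != 0.
  by apply: contraTneq IHn => ->; rewrite mulr0 ltxx.
have P1z : (P n.+1).[z] != 0.
  by apply: contraNneq r0 => ->; rewrite mul0r.
split=> //.
have -> : (P n.+2).[z] / (P n.+1).[z] =
    z - OPS_beta n.+1 - OPS_lambda n / ((P n.+1).[z] / (P n).[z]).
  by rewrite OPS_recurrence !hornerE /=; field; rewrite ?P1z ?Pz.
have := OPS_lambda_gt0 (@OPS_real_on_line n) (@OPS_real_on_line n.+1).
move: (_ / _) r0 IHn (OPS_lambda n) (OPS_beta n.+1) (br n.+1).
case: z z0 {Pz P1z} => a b /= b0 [c d] r0 IHn [l l'] [e e'] /= ->.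
rewrite ltcE /= => /andP[/eqP-> l_gt0]; rewrite !mul0r addr0 subr0.
have cd : 0 < c ^+ 2 + d ^+ 2.
  rewrite lt_neqAle addr_ge0 ?sqr_ge0 // andbT eq_sym paddr_eq0 ?sqr_ge0 //.
  by rewrite !sqrf_eq0; apply: contraNN r0 => /andP[/eqP-> /eqP->].
(* With [c + i d] the previous ratio, [b * d > 0] is the induction hypothesis, so both terms are
   positive. *)
have -> : b * (b - l * - (d / (c ^+ 2 + d ^+ 2))) =
  b ^+ 2 + l * (b * d) / (c ^+ 2 + d ^+ 2) by ring.
by rewrite addr_gt0 ?exprn_even_gt0 // divr_gt0 // mulr_gt0.
Qed.

Lemma OPS_ratio_neq (z w : R[i]) (n : nat) : opposite_half_planes z w ->
  (P n.+1).[z] / (P n).[z] != (P n.+1).[w] / (P n).[w].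
Proof.
move=> zw.
have [z0 w0 zwN] : [/\ complex.Im z != 0, complex.Im w != 0 &
    complex.Im w * complex.Im z < 0].
  rewrite !neq_lt; case: zw => -[z0 w0]; rewrite z0 w0 ?orbT; split=> //.
    by rewrite nmulr_rlt0.
  by rewrite pmulr_rlt0.
have [_ rz] := OPS_ratio_Im n z0; have [_ rw] := OPS_ratio_Im n w0.
apply: contraTneq rz => ->; rewrite -leNgt.
(* For a common ratio, the two products of imaginary parts multiply to [Im w * Im z] times a square,
   which is at most 0. *)
by rewrite -(pmulr_rle0 _ rw) mulrACA -expr2 nmulr_rle0 ?sqr_ge0.
Qed.

(* With [r = P_(n+1)(k1)/P_n(k1)] and [s = P_(n+1)(k2)/P_n(k2)], the recurrence
   gives [b - OPS_lambda n = (k2 - k1) * r * s / (s - r)]. *)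
Lemma iterated_kernel_expansion (k1 k2 : R[i]) (n : nat) :
  opposite_half_planes k1 k2 ->
  exists a b : R[i], b != OPS_lambda n /\
    ('X - k1%:P) * ('X - k2%:P) * iterated_kernel_poly P k1 k2 n =
      P n.+2 + a *: P n.+1 + b *: P n.
Proof.
move=> k12.
have [k1N k2N k12N] : [/\ complex.Im k1 != 0, complex.Im k2 != 0 & k2 - k1 != 0].
  rewrite subr_eq0; case: k12 => -[i1 i2]; rewrite !neq_lt i1 i2 ?orbT; split=> //;
    by apply: contraTneq i1 => <-; rewrite -leNgt ltW.
have P1 k : (P k).[k1] != 0 by case: (OPS_ratio_Im k k1N).
have P2 k : (P k).[k2] != 0 by case: (OPS_ratio_Im k k2N).
have KE k : (kernel_poly P k1 k).[k2] =
    ((P k.+1).[k2] - (P k.+1).[k1] / (P k).[k1] * (P k).[k2]) / (k2 - k1).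
  have := congr1 (horner_eval k2) (kernel_polyE (P1 k)).
  by rewrite /horner_eval !hornerE /= => <-; field.
(* Distinct ratios keep the first kernel nonzero at [k2], so the second quotient is exact. *)
have den k : (P k.+1).[k2] - (P k.+1).[k1] / (P k).[k1] * (P k).[k2] != 0.
  rewrite subr_eq0; apply: contraNneq (OPS_ratio_neq k k12) => ->.
  by rewrite mulfK.
have K0 k : (kernel_poly P k1 k).[k2] != 0.
  by rewrite KE mulf_neq0 ?invr_eq0.
pose r k := (P k.+1).[k1] / (P k).[k1].
pose e := (kernel_poly P k1 n.+1).[k2] / (kernel_poly P k1 n).[k2].
(* The coefficients come from expanding [P n.+2 - r n.+1 *: P n.+1 - e *: (P n.+1 - r n *: P n)]. *)
exists (- r n.+1 - e), (e * r n); split; last first.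
  rewrite -mulrA (kernel_polyE (K0 n)) -/e mulrBr -scalerAr !kernel_polyE //.
  by rewrite -/(r _) -!mul_polyC !(polyCD, polyCN, polyCM); ring.
rewrite -subr_eq0.
suff -> : e * r n - OPS_lambda n =
    (k2 - k1) * (P n.+1).[k2] * r n / ((P n.+1).[k2] - r n * (P n).[k2]).
  by rewrite /r !mulf_neq0 ?invr_eq0.
rewrite /e !KE /r; move: (den n) (P1 n) (P1 n.+1).
rewrite OPS_recurrence !hornerE /=.
move=> d0 p0 p1; field; rewrite k12N p0 p1 andbT /=.
(* The remaining denominator is the one in [d0] multiplied by [(P n).[k1]]. *)
by rewrite -(divfK p0 (P n.+1).[k1]) mulrAC -mulrBl mulf_neq0.
Qed.

End Orthogonality.

Theorem theorem6p4 (R : realType) (L : {scalar {poly R[i]}})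
    (P : nat -> {poly R[i]}) (kappa1 kappa2 : R[i]) (S : nat -> {poly R[i]})
    (L_pos : positive_definite L)
    (P_OPS : monic_OPS L P)
    (kappa12 : opposite_half_planes kappa1 kappa2)
    (S_quasi : forall n : nat, (0 < n)%N -> quasi_orthogonal2 P n (S n.+1)) :
  let relation (gamma upsilon rho : nat -> R[i]) :=
    forall n : nat, (0 < n)%N ->
      S n.+1 - (rho n *: 'X - (gamma n)%:P) * P n
        + upsilon n *: (('X - kappa1%:P) * ('X - kappa2%:P)
                        * iterated_kernel_poly P kappa1 kappa2 n.-1) = 0 in
  exists gamma upsilon rho : nat -> R[i],
    relation gamma upsilon rho /\
    forall gamma' upsilon' rho' : nat -> R[i],
      relation gamma' upsilon' rho' ->
      forall n : nat, (0 < n)%N ->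
        [/\ gamma' n = gamma n, upsilon' n = upsilon n & rho' n = rho n].
Proof.
move=> relation.
(* The equivalence holds existence and uniqueness together, so a single use of [choice] yields
   both. *)
have uniq_coefs n : exists t : R[i] * R[i] * R[i], forall g u r : R[i],
    (0 < n)%N ->
    (S n.+1 - (r *: 'X - g%:P) * P n
      + u *: (('X - kappa1%:P) * ('X - kappa2%:P)
              * iterated_kernel_poly P kappa1 kappa2 n.-1) = 0
     <-> t = (g, u, r)).
  (* At index 0 the guard is false and any triple will do. *)
  case: n => [|n]; first by exists 0.
  have [c [d ->]] := S_quasi n.+1 isT.
  have [a [b [bl ->]]] := iterated_kernel_expansion P_OPS L_pos n kappa12.
  set l := OPS_lambda L P n; set be := OPS_beta L P n.+1.
  have bl0 : b - l != 0 by rewrite subr_eq0.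
  pose u0 := (l - d) / (b - l).
  (* The coefficient of [P n.+2] forces [r = 1 + u]; that of [P n] then gives [u], and that of
     [P n.+1] gives [g]. *)
  exists ((1 + u0) * be - c - u0 * a, u0, 1 + u0) => g u r _.
  have -> : P n.+2 + c *: P n.+1 + d *: P n - (r *: 'X - g%:P) * P n.+1
      + u *: (P n.+2 + a *: P n.+1 + b *: P n) =
    (1 + u - r) *: P n.+2 + (c - r * be + g + u * a) *: P n.+1
      + (d - r * l + u * b) *: P n.
    rewrite (OPS_recurrence P_OPS) -/l -/be -!mul_polyC.
    by rewrite !(polyCD, polyCN, polyCM); ring.
  split=> [/(OPS_lin_indep P_OPS)[rE gE uE]|[<- <- <-]].
    have {}rE : r = 1 + u by apply/eqP; rewrite eq_sym -subr_eq0 rE.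
    have {}uE : u = u0.
      apply: (canRL (mulfK bl0)); apply/eqP; rewrite -subr_eq0 -uE rE.
      by apply/eqP; ring.
    rewrite -uE -rE; congr (_, _, _); apply/eqP; rewrite eq_sym -subr_eq0 -gE.
    by apply/eqP; ring.
  have -> : d - (1 + u0) * l + u0 * b = 0 by rewrite /u0; field.
  have -> : c - (1 + u0) * be + ((1 + u0) * be - c - u0 * a) + u0 * a = 0 by ring.
  by rewrite subrr !scale0r !addr0.
have [t tE] := choice uniq_coefs.
exists (fun n => (t n).1.1), (fun n => (t n).1.2), (fun n => (t n).2).
split=> [n n0|g u r rel n n0]; first by apply/tE => //; case: (t n) => [[]].
by have /tE -> := rel n n0.
Qed.
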